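(* Let $\mathcal{X}$ be a nonsingular, projective, geometrically irreducible algebraic curve of positive genus over $\mathbb{F}_q$, let $m\geq 2$, and let $\mathbf{Q}=(Q_1,\ldots,Q_m)$ be an $m$-tuple of pairwise distinct rational points on $\mathcal{X}$. Assume that $q\geq m$. Then the set $G(\mathbf{Q})$ of Weierstrass gaps of $\mathcal{X}$ at $\mathbf{Q}$ satisfies $$G(\mathbf{Q})=\bigcup_{\boldsymbol{\beta}^*\in\Lambda(\mathbf{Q})} \left(\overline{\nabla}(\boldsymbol{\beta}^* )\cap \mathbb{N}_0^m\right).$$
   Context: $\mathbb{N}_0$ is the set of nonnegative integers and $I=\{1,\ldots,m\}$. For a rational function $h$, $v_{Q_i}(h)$ is its valuation at $Q_i$ and $\mathrm{div}_\infty(h)$ is its divisor of poles. Classical Weierstrass semigroup and gaps: $H(\mathbf{Q})=\{(\alpha_1,\ldots,\alpha_m)\in\mathbb{N}_0^m : \exists\, h\in\mathbb{F}_q(\mathcal{X})^\times \text{ with } \mathrm{div}_\infty(h)=\sum_{i=1}^m\alpha_iQ_i\}$ and $G(\mathbf{Q})=\mathbb{N}_0^m\setminus H(\mathbf{Q})$. Generalized Weierstrass semigroup: let $R_{\mathbf{Q}}$ be the set of functions in $\mathbb{F}_q(\mathcal{X})$ regular outside $\{Q_1,\ldots,Q_m\}$; then $\widehat{H}(\mathbf{Q})=\{(-v_{Q_1}(h),\ldots,-v_{Q_m}(h))\in\mathbb{Z}^m : h\in R_{\mathbf{Q}}\setminus\{0\}\}$. For $\boldsymbol{\alpha}\in\mathbb{Z}^m$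 and a nonempty $J\subsetneq I$: $\overline{\nabla}_J(\boldsymbol{\alpha})=\{\boldsymbol{\beta}\in\mathbb{Z}^m : \beta_j=\alpha_j \text{ for } j\in J \text{ and } \beta_i<\alpha_i \text{ for } i\notin J\}$ and $\nabla_J(\boldsymbol{\alpha})=\overline{\nabla}_J(\boldsymbol{\alpha})\cap\widehat{H}(\mathbf{Q})$. Write $\overline{\nabla}_i=\overline{\nabla}_{\{i\}}$, $\overline{\nabla}(\boldsymbol{\alpha})=\bigcup_{i=1}^m\overline{\nabla}_i(\boldsymbol{\alpha})$ and $\nabla(\boldsymbol{\alpha})=\overline{\nabla}(\boldsymbol{\alpha})\cap\widehat{H}(\mathbf{Q})$. An element $\boldsymbol{\alpha}\in\widehat{H}(\mathbf{Q})$ is maximal if $\nabla(\boldsymbol{\alpha})=\emptyset$; it is relative maximal if it is maximal and $\nabla_J(\boldsymbol{\alpha})\neq\emptyset$ for every $J\subsetneq I$ with $\#J\geq 2$. $\widehat{\Lambda}(\mathbf{Q})$ denotes the set of relative maximal elements of $\widehat{H}(\mathbf{Q})$, and $\Lambda(\mathbf{Q})=\widehat{\Lambda}(\mathbf{Q})\cap\mathbb{N}_0^m$. *)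

(* Defs.v *)
From HB Require Import structures.
From mathcomp Require Import all_boot all_order all_algebra.
From mathcomp Require Import boolp classical_sets functions cardinality fsbigop.

Set Implicit Arguments.
Unset Strict Implicit.
Unset Printing Implicit Defensive.

Import Order.TTheory GRing.Theory Num.Theory.
Local Open Scope classical_set_scope.
Local Open Scope ring_scope.

(* A nonsingular projective geometrically irreducible curve over the finite
   field k is given by its function field: a finite extension of some k(x), x
   transcendental over k, in which k is algebraically closed.  As k is perfect,
   the last condition is geometric irreducibility.  In [ffield_finite] the
   coefficients p_i(x) / q(x) in k(x) are written with a common denominator. *)
Record curve (k : finFieldType) := Curve {
  ffield : fieldType;
  ffconst : {rmorphism k -> ffield};
  ffield_finite : exists x : ffield, ~ algebraicOver ffconst x /\
    exists (n : nat) (b : 'I_n -> ffield), forall y : ffield,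
      exists (p : 'I_n -> {poly k}) (q : {poly k}), q != 0 /\
        y = \sum_(i < n)
              ((map_poly ffconst (p i)).[x] / (map_poly ffconst q).[x]) * b i;
  ffconst_closed : forall y : ffield,
    algebraicOver ffconst y -> exists c : k, y = ffconst c
}.

(* The closed points of the nonsingular projective model are the normalized
   discrete valuations of the function field that are trivial on k.  Valuations
   take values in int, so the infinite value at 0 is replaced by the junk value
   0; prescribing it makes distinct points differ on some nonzero function.  *)
Record closed_point (k : finFieldType) (X : curve k) := ClosedPoint {
  vord : ffield X -> int;
  vord0 : vord 0 = 0;
  vordM : forall f h, f != 0 -> h != 0 -> vord (f * h) = vord f + vord h;
  vordD : forall f h, f != 0 -> h != 0 -> f + h != 0 ->
    Num.min (vord f) (vord h) <= vord (f + h);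
  vord_const : forall c : k, c != 0 -> vord (ffconst X c) = 0;
  vord_normalized : exists2 t, t != 0 & vord t = 1
}.

HB.instance Definition _ (k : finFieldType) (X : curve k) :=
  gen_eqMixin (closed_point X).
HB.instance Definition _ (k : finFieldType) (X : curve k) :=
  gen_choiceMixin (closed_point X).

Section Curve.
Variables (k : finFieldType) (X : curve k).
Local Notation F := (ffield X).
Implicit Types (P : closed_point X) (A : closed_point X -> int).

(* dim_k (V / W), for k-subspaces W of V; junk value 0 when it is infinite. *)
Definition is_dim_quo (V W : set F) (n : nat) : Prop :=
  exists b : 'I_n -> F, (forall i, V (b i)) /\
    forall f, V f -> exists! c : {ffun 'I_n -> k},
      W (f - \sum_(i < n) ffconst X (c i) * b i).

Definition dim_quo (V W : set F) : nat := xget 0%N (is_dim_quo V W).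

Definition local_ring P : set F := [set f | f != 0 -> 0 <= vord P f].
Definition local_ideal P : set F := [set f | f != 0 -> 0 < vord P f].

Definition point_degree P : nat := dim_quo (local_ring P) (local_ideal P).
Definition rational_point P : Prop :=
  is_dim_quo (local_ring P) (local_ideal P) 1.

Definition is_divisor A : Prop := finite_set [set P | A P != 0].

Definition divisor_degree A : int :=
  \sum_(P \in [set: closed_point X]) A P * (point_degree P)%:Z.

Definition riemann_roch_space A : set F :=
  [set f | f != 0 -> forall P, - A P <= vord P f].

Definition ell A : nat := dim_quo (riemann_roch_space A) [set 0].

(* The genus is the maximum of deg A - ell A + 1 over all divisors A. *)
Definition is_genus (g : nat) : Prop :=
  (exists2 A, is_divisor A & divisor_degree A - (ell A)%:Z + 1 = g%:Z) /\
  (forall A, is_divisor A -> divisor_degree A - (ell A)%:Z + 1 <= g%:Z).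

Definition genus : nat := xget 0%N is_genus.

Definition pole_divisor (h : F) : closed_point X -> int :=
  fun P => Num.max 0 (- vord P h).

Variables (m : nat) (Q : 'I_m -> closed_point X).
Implicit Types (a b : {ffun 'I_m -> int}) (J : {set 'I_m}).

Definition nonneg_tuples : set {ffun 'I_m -> int} :=
  [set a | forall i, 0 <= a i].

Definition divisor_at a : closed_point X -> int :=
  fun P => \sum_(i < m) a i *+ (P == Q i).

Definition weierstrass_semigroup : set {ffun 'I_m -> int} :=
  [set a | nonneg_tuples a /\
           exists2 h : F, h != 0 & pole_divisor h = divisor_at a].

Definition weierstrass_gaps : set {ffun 'I_m -> int} :=
  nonneg_tuples `\` weierstrass_semigroup.

Definition regular_outside : set F :=
  [set h | forall P, (forall i, P <> Q i) -> local_ring P h].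

Definition generalized_semigroup : set {ffun 'I_m -> int} :=
  [set [ffun i => - vord (Q i) h] | h in regular_outside `\ 0].

Definition nabla_bar_on J a : set {ffun 'I_m -> int} :=
  [set b | (forall j, j \in J -> b j = a j) /\
           (forall i, i \notin J -> b i < a i)].

Definition nabla_on J a : set {ffun 'I_m -> int} :=
  nabla_bar_on J a `&` generalized_semigroup.

Definition nabla_bar a : set {ffun 'I_m -> int} :=
  \bigcup_(i in [set: 'I_m]) nabla_bar_on [set i]%SET a.

Definition nabla a : set {ffun 'I_m -> int} :=
  nabla_bar a `&` generalized_semigroup.

Definition is_maximal a : Prop := generalized_semigroup a /\ nabla a = set0.

Definition relative_maximal : set {ffun 'I_m -> int} :=
  [set a | is_maximal a /\
     forall J, J \proper [set: 'I_m]%SET -> (2 <= #|J|)%N ->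
       nabla_on J a <> set0].

Definition nonneg_relative_maximal : set {ffun 'I_m -> int} :=
  relative_maximal `&` nonneg_tuples.

End Curve.

Arguments nonneg_tuples {m}.
Arguments nabla_bar {m} a.

(* Main.v *)
(* If a is a gap then, a space over a field with q elements not being a union
   of at most q proper subspaces, for some i no function in L(a) has order
   exactly -a_i at Q_i.  Call this property of a "i-blocked".  By Riemann's
   inequality all large integers are pole orders at a rational point; products
   of such functions give, for j <> i, a function with order -a_i at Q_i whose
   other poles are only at Q_j.  Hence raising the coordinates other than i
   keeps a i-blocked only boundedly far, and there is a largest i-blocked c
   with c_i = a_i and c >= a.  Then b = c + sum_(j <> i) e_j is relative
   maximal: maximality of c gives, for each j <> i, a function with orders
   exactly -b_i, -b_j at Q_i, Q_j and larger than -b_l at the other Q_l, and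
   avoiding at most q hyperplanes in spaces spanned by these (or by their
   differences, when i is not in J) makes every nabla_J(b) with |J| >= 2
   nonempty. *)

Require Import Defs.
From HB Require Import structures.
From mathcomp Require Import all_boot all_order all_algebra.
From mathcomp Require Import boolp classical_sets functions cardinality fsbigop.
From mathcomp Require Import zify ring.

Set Implicit Arguments.
Unset Strict Implicit.
Unset Printing Implicit Defensive.

Import Order.TTheory GRing.Theory Num.Theory.
Local Open Scope classical_set_scope.
Local Open Scope ring_scope.

(** * Linear algebra over a finite field: avoiding proper subspaces *)

Section Subspaces.
Variables (k : finFieldType) (F : fieldType) (phi : {rmorphism k -> F}).

Definition subspace (V : set F) : Prop :=
  V 0 /\ forall c f g, V f -> V g -> V (phi c * f + g).

Variable V : set F.
Hypothesis subV : subspace V.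

Lemma subspaceZ c f : V f -> V (phi c * f).
Proof. by case: subV => V0 VD Vf; rewrite -[_ * _]addr0; apply: VD. Qed.

Lemma subspaceD f g : V f -> V g -> V (f + g).
Proof. by case: subV => _ VD Vf Vg; rewrite -[f]mul1r -(rmorph1 phi); apply: VD. Qed.

Lemma subspaceN f : V f -> V (- f).
Proof. by rewrite -mulN1r -(rmorphN1 phi); apply: subspaceZ. Qed.

Lemma subspaceB f g : V f -> V g -> V (f - g).
Proof. by move=> Vf /subspaceN; apply: subspaceD. Qed.

Lemma subspaceZ_inv c f : c != 0 -> V (phi c * f) -> V f.
Proof.
move=> c0 /(subspaceZ c^-1).
by rewrite mulrA -rmorphM mulVf // rmorph1 mul1r.
Qed.

Lemma subspace_sum n (c : 'I_n -> k) (b : 'I_n -> F) :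
  (forall i, V (b i)) -> V (\sum_i phi (c i) * b i).
Proof.
move=> Vb; case: subV => V0 VD.
elim/big_rec: _ => [//|i x _ Vx]; exact: VD.
Qed.

End Subspaces.

(* The |k| + 1 lines of a plane spanned by [f] and [g] are the lines through
   [f] and through the [c f + g]; each proper subspace contains at most one. *)
Lemma subspace_avoidance (k : finFieldType) (F : fieldType)
    (phi : {rmorphism k -> F}) (I : eqType) (s : seq I) (V : set F)
    (U : I -> set F) :
  subspace phi V -> (forall i, subspace phi (U i)) -> (size s <= #|k|)%N ->
  (forall i, i \in s -> exists2 f, V f & ~ U i f) ->
  exists2 f, V f & forall i, i \in s -> ~ U i f.
Proof.
move=> subV subU; elim: s => [|j s IH] /= les ex.
  by exists 0 => //; case: subV.
have [||g Vg gU] := IH; first exact: ltnW.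
  by move=> i si; apply: ex; rewrite inE si orbT.
have [|f Vf fU] := ex j; first by rewrite mem_head.
have [fs|/existsNP[i0 /not_implyP[si0 /contrapT Uf]]] :=
    pselect (forall i, i \in s -> ~ U i f).
  by exists f => // i; rewrite inE => /predU1P[->|/fs].
apply: contrapT => no.
have /choice[iota iotaP] : forall c : k, exists i,
    i \in j :: s /\ U i (phi c * f + g).
  move=> c; apply: contrapT => noi; apply: no; exists (phi c * f + g).
    by case: subV => _; apply.
  by move=> i si Ui; apply: noi; exists i.
(* Two combinations in one subspace would put both [f] and [g] there, but [f] avoids [U j] and [g]
   avoids [U i] for all [i] in [s]. *)
have iota_inj : injective iota.
  move=> c d eqi; apply/eqP; apply: contrapT => /negP; rewrite -subr_eq0 => cd.
  have [si Uc] := iotaP c; have [_] := iotaP d; rewrite -eqi => Ud.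
  have Uf' : U (iota c) f.
    apply: (subspaceZ_inv (subU _) cd).
    have -> : phi (c - d) * f = (phi c * f + g) - (phi d * f + g).
      by rewrite rmorphB; ring.
    exact: subspaceB.
  have Ug : U (iota c) g.
    have -> : g = (phi c * f + g) - phi c * f by ring.
    by apply: (subspaceB (subU _)) => //; apply: (subspaceZ (subU _)).
  by move: si; rewrite inE => /predU1P[eqj|/gU//]; apply: fU; rewrite -eqj.
(* [U i0] contains [f] but not [g], so it contains no [phi c * f + g]: the [#|k|] distinct indices
   [iota c] all differ from [i0], leaving at most [size s] of them. *)
have : (#|k| <= size [seq i <- j :: s | i != i0])%N.
  rewrite cardE -(size_map iota); apply: uniq_leq_size.
    by rewrite map_inj_uniq // enum_uniq.
  move=> _ /mapP[c _ ->]; have [si Uc] := iotaP c.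
  rewrite mem_filter si andbT; apply/eqP => ei; apply: (gU _ si0).
  rewrite ei in Uc; have -> : g = (phi c * f + g) - phi c * f by ring.
  by apply: (subspaceB (subU _)) => //; apply: (subspaceZ (subU _)).
have := count_predC (pred1 i0) s; rewrite size_filter /=.
have : (0 < count_mem i0 s)%N by rewrite -has_count has_pred1.
have -> : count (fun i => i != i0) s = count (predC (pred1 i0)) s by [].
by move: (j != i0) les => [] /=; lia.
Qed.

(** * Orders of functions at rational points *)

Section Points.
Variables (k : finFieldType) (X : curve k).
Local Notation F := (ffield X).
Local Notation phi := (ffconst X).
Implicit Types (P : closed_point X) (A : closed_point X -> int) (f g h : F).

(** The premise [f != 0] gives 0 infinite order in place of its junk value, so that this is a
    [k]-subspace. *)
Definition ord_ge P (n : int) : set F := [set f | f != 0 -> n <= vord P f].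

Lemma vord1 P : vord P 1 = 0.
Proof. by rewrite -(rmorph1 phi) vord_const // oner_eq0. Qed.

Lemma vordV P f : f != 0 -> vord P f^-1 = - vord P f.
Proof.
move=> f0; have := vord1 P; rewrite -(divff f0) vordM ?invr_eq0 //.
by move=> /eqP; rewrite addrC addr_eq0 => /eqP.
Qed.

Lemma vordX P f n : f != 0 -> vord P (f ^+ n) = vord P f * n%:Z.
Proof.
move=> f0; elim: n => [|n IH]; first by rewrite expr0 vord1 mulr0.
by rewrite exprS vordM ?expf_neq0 // IH; lia.
Qed.

Lemma ord_geM P n p f g : ord_ge P n f -> ord_ge P p g -> ord_ge P (n + p) (f * g).
Proof.
move=> nf pg; rewrite /ord_ge /= mulf_eq0 negb_or => /andP[f0 g0].
by rewrite vordM // lerD ?nf ?pg.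
Qed.

Lemma ord_geW P n p f : p <= n -> ord_ge P n f -> ord_ge P p f.
Proof. by move=> pn nf /nf; apply: le_trans. Qed.

Lemma ord_ge_const P c : ord_ge P 0 (phi c).
Proof. by rewrite /ord_ge /= fmorph_eq0 => /vord_const ->. Qed.

Lemma subspace_ord_ge P n : subspace phi (ord_ge P n).
Proof.
have ord_geD f g : ord_ge P n f -> ord_ge P n g -> ord_ge P n (f + g).
  move=> nf ng fg0; have [f0|f0] := eqVneq f 0.
    by move: fg0; rewrite f0 add0r; apply: ng.
  have [g0|g0] := eqVneq g 0; first by move: fg0; rewrite g0 addr0; apply: nf.
  by apply: le_trans (vordD P f0 g0 fg0); rewrite le_min nf ?ng.
split=> [|c f g nf ng]; first by rewrite /ord_ge /= eqxx.
apply: ord_geD => //; rewrite -[n]add0r; apply: ord_geM => //.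
exact: ord_ge_const.
Qed.

Lemma subspace_riemann_roch (A : closed_point X -> int) :
  subspace phi (riemann_roch_space A).
Proof.
have E : riemann_roch_space A = [set f | forall P, ord_ge P (- A P) f].
  by apply/seteqP; split=> f Af; [move=> P f0|move=> f0 P]; apply: Af.
rewrite E; split=> [P|c f g Af Ag P]; have [? D] := subspace_ord_ge P (- A P).
  by [].
exact: D.
Qed.

(** The residue field at a rational point is [k], so [g / f], regular at [P], is congruent to a
    constant. The basis vector [b0] of the residue field need not be 1, whence the quotient
    [c2 / c1]. *)
Lemma leading_coef_sub P f g : rational_point P -> f != 0 ->
  ord_ge P (vord P f) g ->
  exists c, ord_ge P (vord P f + 1) (g - phi c * f).
Proof.
case=> b [lb b1] f0 gf.
have loc1 : local_ring P 1 by move=> _; rewrite vord1.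
have locq : local_ring P (g / f).
  move=> q0; have g0 : g != 0 by apply: contraNneq q0 => ->; rewrite mul0r.
  by rewrite vordM ?invr_eq0 // vordV // subr_ge0 gf.
have [c1 [+ _]] := b1 _ loc1; have [c2 [+ _]] := b1 _ locq.
rewrite !big_ord_recl !big_ord0 !addr0.
move: (c1 ord0) (c2 ord0) (b ord0) => {}c1 {}c2 b0 I2 I1.
have I1' : ord_ge P 1 (1 - phi c1 * b0) by [].
have I2' : ord_ge P 1 (g / f - phi c2 * b0) by [].
have c10 : c1 != 0.
  apply/eqP => c10; move: I1; rewrite c10 rmorph0 mul0r subr0 => /(_ (oner_neq0 _)).
  by rewrite vord1.
exists (c2 / c1).
have -> : g - phi (c2 / c1) * f =
    f * ((g / f - phi c2 * b0) - phi (c2 / c1) * (1 - phi c1 * b0)).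
  have := c10; rewrite -(fmorph_eq0 phi) rmorphM fmorphV => phi0.
  by move: (phi c1) (phi c2) phi0 => d1 d2 phi0; field; rewrite f0 phi0.
apply: ord_geM => //.
apply: (subspaceB (subspace_ord_ge P 1)) => //.
exact: (subspaceZ (subspace_ord_ge P 1)).
Qed.

(** * Dimensions, Riemann's inequality and pole orders at one point *)

Lemma dim_le_span (V : set F) n s (b : 'I_s -> F) :
  subspace phi V -> is_dim_quo V [set 0] n ->
  (forall f, V f -> exists c : {ffun 'I_s -> k}, f = \sum_i phi (c i) * b i) ->
  (n <= s)%N.
Proof.
move=> subV [b' [Vb' b'V]] span.
have Vs (c : {ffun 'I_n -> k}) : V (\sum_i phi (c i) * b' i).
  exact: subspace_sum.
have /choice[t tP] := fun c => span _ (Vs c).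
have t_inj : injective t.
  move=> c d eqt; have := tP d; rewrite -eqt -tP => E.
  have [e [_ eu]] := b'V _ (Vs c); transitivity e.
    by symmetry; apply: eu; rewrite /= subrr.
  by apply: eu; rewrite /= E subrr.
(* As [k] is finite, dimensions are compared by counting coordinate vectors. *)
have := leq_card t t_inj; rewrite !card_ffun !card_ord.
by rewrite leq_exp2l // card_finNzRing_gt1.
Qed.

(** Whatever value [xget] picks satisfies [is_dim_quo], and dimension 0 would put 1 in the maximal
    ideal. *)
Lemma point_degree_gt0 P : rational_point P -> (0 < point_degree P)%N.
Proof.
move=> ratP; rewrite /point_degree /dim_quo.
have := xgetI 0%N ratP; case: (xget _ _) => // -[b [_ bP]].
have [|c [+ _]] := bP 1; first by move=> _; rewrite vord1.
by rewrite big_ord0 subr0 => /(_ (oner_neq0 _)); rewrite vord1.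
Qed.

Definition point_multiple P (n : int) : closed_point X -> int :=
  fun P' => n *+ (P' == P).

Lemma divisor_point_multiple P n : is_divisor (point_multiple P n).
Proof.
apply: (sub_finite_set (B := [set P])) => [P' /=|]; last exact: finite_set1.
by rewrite /point_multiple; case: (P' =P P) => // _; rewrite mulr0n eqxx.
Qed.

Lemma degree_point_multiple P n :
  divisor_degree (point_multiple P n) = n * (point_degree P)%:Z.
Proof.
rewrite /divisor_degree -(fsbig_widen [set P]) //.
  by rewrite fsbig_set1 /point_multiple eqxx.
by move=> P' [_ /= /eqP/negPf nP]; rewrite /point_multiple nP mulr0n mul0r.
Qed.

(** Positivity excludes the default 0 of [xget], so [genus X] is the maximum in [is_genus]. *)
Lemma riemann_inequality : (0 < genus X)%N -> forall A, is_divisor A ->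
  divisor_degree A - (ell A)%:Z + 1 <= (genus X)%:Z.
Proof.
rewrite /genus; case: xgetP => // g _ [_ gP] _ A; exact: gP.
Qed.

(* [ell] takes its junk value 0 on an infinite-dimensional space, so Riemann's
   inequality also gives that the spaces L(nP) are finite-dimensional. *)
Lemma eventually_pole_order P : (0 < genus X)%N -> rational_point P ->
  exists n0 : nat, forall n : nat, (n0 <= n)%N ->
    exists f, [/\ f != 0, vord P f = - n%:Z &
      forall P', P' != P -> 0 <= vord P' f].
Proof.
move=> g0 ratP.
pose L (n : nat) := riemann_roch_space (point_multiple P n).
pose l (n : nat) := ell (point_multiple P n).
have ln (n : nat) : (n + 1 <= genus X + l n)%N.
  have := riemann_inequality g0 (divisor_point_multiple P n).
  rewrite degree_point_multiple -/(l n).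
  by have := point_degree_gt0 ratP; nia.
have dimL (n : nat) : (genus X <= n)%N -> is_dim_quo (L n) [set 0] (l n).
  move=> gn; have := ln n; rewrite /l /ell /dim_quo -/(L n).
  by case: xgetP => //; lia.
have subL n : subspace phi (L n) by exact: subspace_riemann_roch.
have Lord n f : f != 0 -> L n f -> - n%:Z <= vord P f.
  by move=> f0 /(_ f0 P); rewrite /point_multiple eqxx.
have LP n f : - n%:Z <= vord P f ->
    (forall P', P' != P -> 0 <= vord P' f) -> L n f.
  move=> nP nP' f0 P'; rewrite /point_multiple.
  by case: eqP => [->//|/eqP neP]; rewrite mulr0n oppr0 nP'.
have L_other n f : f != 0 -> L n f -> forall P', P' != P -> 0 <= vord P' f.
  move=> f0 /(_ f0) + P' nP => /(_ P').
  by rewrite /point_multiple (negPf nP) mulr0n oppr0.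
have Lpred n f : L n.+1 f -> ord_ge P (- n%:Z) f -> L n f.
  move=> Lf nf f0; apply: LP => //; [exact: nf|exact: L_other Lf].
pose gap n := forall f, f != 0 -> L n f -> vord P f <> - n%:Z.
(* At a gap [n.+1] the spaces [L n.+1] and [L n] agree, so a basis of [L n] spans both. *)
have l_gap n : (genus X <= n)%N -> gap n.+1 -> (l n.+1 <= l n)%N.
  move=> gn gapn; have [b [_ bP]] := dimL n gn.
  apply: (dim_le_span (subL n.+1) (dimL n.+1 (leqW gn)) (b := b)) => f Lf.
  have [|c [/eqP + _]] := bP f; last by rewrite subr_eq0 => /eqP ->; exists c.
  apply: Lpred => // f0; have := Lord _ _ f0 Lf; have := gapn f f0 Lf; lia.
have l_step n : (genus X <= n)%N -> (l n.+1 <= (l n).+1)%N.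
  move=> gn; have [gapn|] := pselect (gap n.+1).
    by apply: leqW; apply: l_gap.
  (* A basis of [L n] together with one [f] of pole order exactly [n.+1] spans [L n.+1]. *)
  move=> /existsNP[f /not_implyP[f0 /not_implyP[Lf /contrapT vf]]].
  have [b [_ bP]] := dimL n gn.
  apply: (dim_le_span (subL n.+1) (dimL n.+1 (leqW gn))
    (b := fun i => if unlift ord0 i is Some j then b j else f)) => h Lh.
  have [|c ch] := leading_coef_sub (g := h) ratP f0.
    by rewrite vf => h0; apply: Lord.
  have Ln : L n (h - phi c * f).
    apply: Lpred; last by apply: ord_geW ch; rewrite vf; lia.
    apply: (subspaceB (subL _)) => //; exact: (subspaceZ (subL _)).
  have [d [/eqP + _]] := bP _ Ln; rewrite subr_eq0 => /eqP E.
  exists [ffun i => if unlift ord0 i is Some j then d j else c].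
  rewrite big_ord_recl ffunE unlift_none.
  under eq_bigr => i _ do rewrite ffunE liftK.
  by rewrite -E; ring.
have [n0 [gn0 n0P]] : exists n0, (genus X <= n0)%N /\
    forall n, (n0 <= n)%N -> ~ gap n.+1.
  apply: contrapT => no.
  have inf n0 : (genus X <= n0)%N -> exists n, (n0 <= n)%N /\ gap n.+1.
    move=> gn0; apply: contrapT => non; apply: no; exists n0; split=> // n n0n gn.
    by apply: non; exists n.
  have mono n d : (genus X <= n)%N -> (l (n + d) <= l n + d)%N.
    move=> gn; elim: d => [|d IH]; first by rewrite !addn0.
    rewrite !addnS; have := l_step (n + d)%N; lia.
  (* With infinitely many gaps, [l n] falls behind the growth of [n] by any amount [e]; falling
     behind by [l (genus X) + 1] contradicts [ln]. *)
  have bad e : exists2 n, (genus X <= n)%N & (l n + e <= l (genus X) + (n - genus X))%N.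
    elim: e => [|e [n gn le]]; first by exists (genus X) => //; lia.
    have [p [np gp]] := inf n gn; exists p.+1; first by lia.
    have := l_gap p (leq_trans gn np) gp.
    have := mono n (p - n)%N gn; rewrite subnKC //; lia.
  have [n gn] := bad (l (genus X) + 1)%N.
  by have := ln n; lia.
exists n0.+1 => -[//|n] n0n; have := n0P n n0n.
move=> /existsNP[f /not_implyP[f0 /not_implyP[Lf /contrapT vf]]].
by exists f; split=> //; apply: L_other Lf.
Qed.

(** * Functions with prescribed order at one point and poles confined to two *)

Lemma zero_with_single_pole P P' : (0 < genus X)%N -> rational_point P ->
  rational_point P' -> P' != P ->
  exists f, [/\ f != 0, 0 < vord P f &
    forall P'', P'' != P' -> 0 <= vord P'' f].
Proof.
move=> g0 ratP ratP' neP; have [n0 n0P] := eventually_pole_order g0 ratP'.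
have [f [f0 vf freg]] := n0P n0.+1 (leqnSn _).
(* Here [c] is the value of [f] at [P]. Subtracting it creates a zero, and the pole of [f] at [P']
   keeps the difference nonzero. *)
have [|c] := @leading_coef_sub P 1 f ratP (oner_neq0 _).
  by rewrite vord1 => _; apply: freg; rewrite eq_sym.
rewrite mulr1 vord1 add0r => cf.
have fc0 : f - phi c != 0.
  rewrite subr_eq0; apply/eqP => E; have := @ord_ge_const P' c.
  by rewrite -E => /(_ f0); rewrite vf; lia.
exists (f - phi c); split=> //; first exact: cf.
move=> P'' neP''.
apply: (subspaceB (subspace_ord_ge P'' 0)) fc0; last exact: ord_ge_const.
by move=> _; apply: freg.
Qed.

Lemma prescribed_order P P' (a : int) : (0 < genus X)%N -> rational_point P ->
  rational_point P' -> P' != P ->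
  exists f, [/\ f != 0, vord P f = a &
    forall P'', P'' != P -> P'' != P' -> 0 <= vord P'' f].
Proof.
move=> g0 ratP ratP' neP; have [n0 n0P] := eventually_pole_order g0 ratP.
have [z [z0 vz zreg]] := zero_with_single_pole g0 ratP ratP' neP.
(* As [vord P z] is at least 1, this exponent makes [vord P z * s - a] at least [n0], hence a pole
   order at [P]; the poles of [z ^+ s] are only at [P']. *)
pose s := (n0 + `|a|)%N.
have [|f [f0 vf freg]] := n0P (absz (vord P z * s%:Z - a)%R).
  by rewrite /s; nia.
exists (z ^+ s * f); split=> [||P'' nP nP']; first by rewrite mulf_neq0 ?expf_neq0.
  by rewrite vordM ?expf_neq0 // vordX // vf; rewrite /s; nia.
rewrite vordM ?expf_neq0 // vordX //.
by have := zreg _ nP'; have := freg _ nP; nia.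
Qed.

End Points.

(** * Riemann-Roch spaces supported on the chosen points *)

Section Tuples.
Variables (k : finFieldType) (X : curve k) (m : nat) (Q : 'I_m -> closed_point X).
Hypotheses (genus_gt0 : (0 < genus X)%N)
  (Q_rational : forall i, rational_point (Q i)) (Q_inj : injective Q)
  (m_le_k : (m <= #|k|)%N).
Local Notation F := (ffield X).
Local Notation phi := (ffconst X).
Implicit Types (a b : {ffun 'I_m -> int}) (f g h : F) (i j : 'I_m).
Local Notation L a := (riemann_roch_space (divisor_at Q a)).

Lemma divisor_at_point a i : divisor_at Q a (Q i) = a i.
Proof.
rewrite /divisor_at (bigD1 i) //= eqxx big1 ?addr0 // => j /negPf ji.
by rewrite (inj_eq Q_inj) eq_sym ji.
Qed.

Lemma divisor_at_outside a P : (forall i, P <> Q i) -> divisor_at Q a P = 0.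
Proof. by move=> PQ; apply: big1 => i _; case: eqP => // /PQ. Qed.

Lemma riemann_roch_atP a f :
  L a f <-> regular_outside Q f /\ forall i, ord_ge (Q i) (- a i) f.
Proof.
split=> [Lf|[rf af] f0 P].
  split=> [P PQ f0|i f0]; have := Lf f0.
    by move=> /(_ P); rewrite divisor_at_outside // oppr0.
  by move=> /(_ (Q i)); rewrite divisor_at_point.
have [[i ->]|/forallNP PQ] := pselect (exists i, P = Q i).
  by rewrite divisor_at_point af.
by rewrite divisor_at_outside // oppr0; apply: rf.
Qed.

Lemma subspace_regular_outside : subspace phi (regular_outside Q).
Proof.
by split=> [P _|c f g rf rg P PQ]; have [? D] := subspace_ord_ge P 0;
  [|apply: D; [apply: rf|apply: rg]].
Qed.

Lemma not_ord_ge P f n : ord_ge P n f -> ~ ord_ge P (n + 1) f ->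
  f != 0 /\ vord P f = n.
Proof.
by move=> nf /not_implyP[f0]; have := nf f0; split=> //; lia.
Qed.

Lemma generalized_semigroupP b : generalized_semigroup Q b <->
  exists f, [/\ f != 0, regular_outside Q f & forall i, vord (Q i) f = - b i].
Proof.
split=> [[f [rf /eqP f0] <-]|[f [f0 rf vf]]].
  by exists f; split=> // i; rewrite ffunE opprK.
exists f; first by split=> //; apply/eqP.
by apply/ffunP => i; rewrite ffunE vf opprK.
Qed.

(** For each [j] in [J] the functions of larger order at [Q j] form a proper subspace, and there are
    at most [m <= #|k|] of these to avoid. *)
Lemma simultaneous_orders a (J : {set 'I_m}) : (0 < #|J|)%N ->
  (forall j, j \in J -> exists2 f, L a f & ~ ord_ge (Q j) (- a j + 1) f) ->
  exists f, [/\ f != 0, L a f & forall j, j \in J -> vord (Q j) f = - a j].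
Proof.
move=> /card_gt0P[j0 Jj0] ex.
have [|||f Lf fJ] := @subspace_avoidance k F phi _ (enum J) (L a)
    (fun j => ord_ge (Q j) (- a j + 1)) (subspace_riemann_roch _).
- by move=> j; apply: subspace_ord_ge.
- by rewrite -cardE; apply: leq_trans m_le_k; rewrite -[m in (_ <= m)%N]card_ord max_card.
- by move=> j; rewrite mem_enum => /ex.
have fj j : j \in J -> f != 0 /\ vord (Q j) f = - a j.
  move=> Jj; apply: not_ord_ge; last by apply: fJ; rewrite mem_enum.
  by have [_] := (riemann_roch_atP a f).1 Lf.
by exists f; split=> // [|j /fj[]//]; have [] := fj _ Jj0.
Qed.

(** Where [a i = 0], any nonnegative order at [Q i] is allowed, so exact orders matter only at
    positive coordinates; if there are none, 1 serves. *)
Lemma weierstrass_semigroup_orders a : nonneg_tuples a ->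
  (forall i, 0 < a i -> exists2 f, L a f & ~ ord_ge (Q i) (- a i + 1) f) ->
  weierstrass_semigroup Q a.
Proof.
move=> a0 ex; split=> //; pose J := [set i | 0 < a i]%SET.
have [f [f0 Lf fJ]] : exists f,
    [/\ f != 0, L a f & forall j, j \in J -> vord (Q j) f = - a j].
  have [/cards0_eq J0|] := posnP #|J|.
    exists 1; split=> [||j]; rewrite ?oner_eq0 ?J0 ?inE //.
    apply/riemann_roch_atP.
    by split=> [P _ _|i _]; rewrite vord1 // oppr_le0; apply: a0.
  by move=> J0; apply: simultaneous_orders => // j; rewrite inE => /ex.
have [rf af] := (riemann_roch_atP a f).1 Lf.
exists f => //; apply/funext => P; rewrite /pole_divisor.
have [[i ->]|/forallNP PQ] := pselect (exists i, P = Q i).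
  rewrite divisor_at_point; have := fJ i; rewrite inE.
  by have := a0 i; have := af i f0; lia.
by rewrite divisor_at_outside //; have := rf _ PQ f0; lia.
Qed.

(** * Maximal blocked tuples and the relative maximal elements above them *)

Lemma maximal_gap a i : nonneg_tuples a -> L a `<=` ord_ge (Q i) (- a i + 1) ->
  exists c : {ffun 'I_m -> int}, [/\ c i = a i, forall j, a j <= c j,
    L c `<=` ord_ge (Q i) (- c i + 1) &
    forall j, j != i -> exists2 f,
      L [ffun l => c l + (l == j)%:Z] f & ~ ord_ge (Q i) (- c i + 1) f].
Proof.
move=> a0 ai.
pose S (c : {ffun 'I_m -> int}) :=
  [/\ c i = a i, forall j, a j <= c j & L c `<=` ord_ge (Q i) (- c i + 1)].
have /choice[N NP] : forall j, exists N : int, forall c, S c -> c j <= N.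
  move=> j; have [->|ji] := eqVneq j i; first by exists (a i) => c [->].
  have [|h [h0 vh hreg]] := prescribed_order (- a i) genus_gt0
    (Q_rational i) (Q_rational j); first by rewrite (inj_eq Q_inj).
  exists (`|vord (Q j) h|) => c [ci ac cS]; rewrite leNgt; apply/negP => cj.
  (* Once [c j] exceeds the pole order of [h] at [Q j], [h] lies in [L c] with order exactly [- c i]
     at [Q i], so [c] is not blocked. *)
  have /cS/(_ h0) : L c h.
    apply/riemann_roch_atP; split=> [P PQ _|l _].
      by apply: hreg; apply/eqP; apply: PQ.
    have [->|li] := eqVneq l i; first by rewrite vh ci.
    have [->|lj] := eqVneq l j; first by lia.
    have := hreg (Q l); rewrite !(inj_eq Q_inj) => /(_ li lj).
    by have := ac l; have := a0 l; lia.
  by rewrite vh ci; lia.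
apply: contrapT => no.
have step c : S c -> exists2 j, j != i & S [ffun l => c l + (l == j)%:Z].
  move=> [ci ac cS]; apply: contrapT => nostep; apply: no; exists c; split=> // j ji.
  apply: contrapT => nof; apply: nostep; exists j => //; split.
  - by rewrite ffunE eq_sym (negPf ji) addr0.
  - by move=> l; rewrite ffunE; have := ac l; lia.
  - move=> f Lf; rewrite ffunE eq_sym (negPf ji) addr0.
    by apply: contrapT => nf; apply: nof; exists f.
(* Without a maximal tuple, raising one coordinate at a time makes the coordinate sum exceed that of
   the bounds [N]. *)
have long (n : nat) : exists2 c, S c & \sum_l c l = \sum_l a l + n%:Z.
  elim: n => [|n [c Sc sc]]; first by exists a; rewrite ?addr0 //; split.
  have [j ji Sj] := step _ Sc; exists [ffun l => c l + (l == j)%:Z] => //.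
  under eq_bigr do rewrite ffunE.
  have sum1 : \sum_l (l == j)%:Z = 1.
    by rewrite (bigD1 j) //= eqxx big1 ?addr0 // => l /negPf ->.
  by rewrite big_split /= sc sum1 intS; ring.
have [c Sc sc] := long (absz (\sum_l N l - \sum_l a l)%R).+1.
have : \sum_l c l <= \sum_l N l by apply: ler_sum => l _; apply: NP.
by rewrite sc; move: (\sum_l N l) (\sum_l a l) => x y; lia.
Qed.

Lemma gap_below_relative_maximal a i : nonneg_tuples a ->
  (exists j, j != i) -> L a `<=` ord_ge (Q i) (- a i + 1) ->
  exists2 b, nonneg_relative_maximal Q b & nabla_bar_on [set i]%SET b a.
Proof.
move=> a0 [j0 j0i] /(maximal_gap a0)[c [ci ac cS cmax]].
pose b : {ffun 'I_m -> int} := [ffun l => c l + (l != i)%:Z].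
have bi : b i = c i by rewrite ffunE eqxx addr0.
have bE l : l != i -> b l = c l + 1 by move=> li; rewrite ffunE li.
(* By maximality of [c], [f j] has pole order exactly [c i] at [Q i], exactly [c j + 1] at [Q j],
   and at most [c l] elsewhere among the points. The guard [j != i] lets [choice] range over all
   indices. *)
have exF j : exists f, j != i -> [/\ regular_outside Q f,
    ~ ord_ge (Q i) (- c i + 1) f, ~ ord_ge (Q j) (- c j) f,
    ord_ge (Q j) (- c j - 1) f & forall l, l != j -> ord_ge (Q l) (- c l) f].
  have [->|ji] := eqVneq j i; first by exists 0.
  have [f /riemann_roch_atP[rf fc] nf] := cmax j ji; exists f => _.
  have fl l : l != j -> ord_ge (Q l) (- c l) f.
    by move=> lj; have := fc l; rewrite ffunE (negPf lj) addr0.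
  split=> //; last by have := fc j; rewrite ffunE eqxx opprD.
  move=> fj; apply: nf; apply: cS; apply/riemann_roch_atP; split=> // l.
  by have [->|/fl] := eqVneq l j.
have {exF}[f fP] := choice exF.
have orders (J : {set 'I_m}) : (2 <= #|J|)%N -> exists g, [/\ g != 0,
    regular_outside Q g, forall j, j \in J -> vord (Q j) g = - b j &
    forall j, j \notin J -> - b j < vord (Q j) g].
  (* Lowering [b] by one off [J] encodes the strict inequalities of [nabla_on], so only exact orders
     on [J] remain to be achieved. *)
  move=> J2; pose d : {ffun 'I_m -> int} := [ffun l => b l - (l \notin J)%:Z].
  have dJ l : l \in J -> d l = b l by move=> lJ; rewrite ffunE lJ subr0.
  have dJc l : l \in J -> l != i -> - d l = - c l - 1.
    by move=> lJ li; rewrite dJ // bE // opprD.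
  have cd l : l != i -> - d l <= - c l.
    by move=> li; rewrite lerN2 ffunE bE //; case: (l \in J); lia.
  have [||g [g0 /riemann_roch_atP[rg gd] gJ]] := @simultaneous_orders d J.
  - exact: ltnW.
  - have other j : exists2 l, l \in J & l != j.
      have /card_gt0P[l] : (0 < #|J :\ j|)%N.
        by move: J2; rewrite (cardsD1 j J); case: (j \in J) => //; apply: ltnW.
      by rewrite !inE => /andP[lj lJ]; exists l.
    have [iJ|iJ] := boolP (i \in J).
      have Lf l : l \in J -> l != i -> L d (f l).
        move=> lJ li; have [rf _ _ fl fo] := fP _ li.
        apply/riemann_roch_atP; split=> // p.
        have [->|pl] := eqVneq p l.
          by rewrite dJc.
        apply: ord_geW (fo _ pl); have [->|pi] := eqVneq p i; first by rewrite dJ // bi.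
        exact: cd.
      move=> j jJ; have [->|ji] := eqVneq j i.
        have [l lJ li] := other i; exists (f l); first exact: Lf.
        by rewrite dJ // bi; have [] := fP _ li.
      exists (f j); first exact: Lf.
      have [_ _ + _ _] := fP _ ji; apply: contra_not; rewrite dJ // bE //.
      by apply: ord_geW; lia.
    (* Off [J], the pole of [f j] at [Q i] is one too large. A multiple of [f l] cancels its leading
       term; at [Q j] the pole order of [f l] is at most [c j < b j], so that of [f j] survives. *)
    move=> j jJ; have [l lJ lj] := other j.
    have ji : j != i by apply: contraNneq iJ => <-.
    have li : l != i by apply: contraNneq iJ => <-.
    have [rfj nfi nfj fj fjo] := fP _ ji.
    have [rfl nli nlj fl flo] := fP _ li.
    have [||l0 vl] := @not_ord_ge (Q i) (f l) (- c i) => //.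
      by apply: flo; rewrite eq_sym.
    have [|e ev] := leading_coef_sub (g := f j) (Q_rational i) l0.
      by rewrite vl; apply: fjo; rewrite eq_sym.
    exists (f j - phi e * f l).
      apply/riemann_roch_atP; split.
        apply: (subspaceB subspace_regular_outside) => //.
        exact: (subspaceZ subspace_regular_outside).
      move=> p; have [->|pi] := eqVneq p i.
        by apply: ord_geW ev; rewrite vl ffunE iJ bi opprB addrC.
      apply: (subspaceB (subspace_ord_ge _ _));
          last apply: (subspaceZ (subspace_ord_ge _ _)).
        have [->|pj] := eqVneq p j.
          by rewrite dJc.
        exact: ord_geW (cd _ pi) (fjo _ pj).
      have [->|pl] := eqVneq p l.
        by rewrite dJc.
      exact: ord_geW (cd _ pi) (flo _ pl).
    rewrite dJc // subrK => fe; apply: nfj.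
    have -> : f j = (f j - phi e * f l) + phi e * f l by ring.
    apply: (subspaceD (subspace_ord_ge _ _)) => //.
    apply: (subspaceZ (subspace_ord_ge _ _)).
    by apply: flo; rewrite eq_sym.
  exists g; split=> // j jJ; first by rewrite gJ // dJ.
  by have := gd j g0; rewrite ffunE jJ; lia.
exists b.
  split; last by move=> l; rewrite ffunE; have := a0 l; have := ac l; lia.
  split; last first.
    move=> J _ /orders[g [g0 rg gJ gNJ]].
    apply/eqP/set0P; exists [ffun l => - vord (Q l) g]; split.
      split=> l lJ; rewrite ffunE; first by rewrite gJ // opprK.
      by have := gNJ _ lJ; lia.
    by apply/generalized_semigroupP; exists g; split=> // l; rewrite ffunE opprK.
  split.
    (* The full index set shows that [b] itself lies in the generalized semigroup. *)
    have [|g [g0 rg gJ _]] := orders [set: 'I_m]%SET.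
      have := subset_leq_card (finset.subsetT [set i; j0]%SET).
      by rewrite cards2 eq_sym j0i.
    by apply/generalized_semigroupP; exists g; split=> // l; apply: gJ; rewrite inE.
  apply/seteqP; split=> // b' [[j _ [b'j b'l]]].
  move=> /generalized_semigroupP[g [g0 rg vg]].
  have gj : vord (Q j) g = - b j by rewrite vg b'j ?inE.
  have gl l : l != j -> - b l < vord (Q l) g.
    by move=> lj; have := b'l l; rewrite inE vg => /(_ lj); lia.
  (* If [j = i], then [g] lies in [L c] and violates blockedness. Otherwise a multiple of [g]
     cancels the leading term of [f j] at [Q j], bringing it into [L c]; since [g] has order above
     [- c i] at [Q i], so would [f j], a contradiction. *)
  have [ji|ji] := eqVneq j i.
    have /cS/(_ g0) : L c g.
      apply/riemann_roch_atP; split=> // l _.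
      have [->|lj] := eqVneq l j; first by rewrite gj ji bi.
      by have := gl _ lj; rewrite bE -?ji //; lia.
    by rewrite -ji gj ji bi; lia.
  have [rfj nfi nfj fj fjo] := fP _ ji.
  have [|e] := leading_coef_sub (g := f j) (Q_rational j) g0.
    by rewrite gj bE // opprD.
  rewrite gj bE // => ev.
  have gi : ord_ge (Q i) (- c i + 1) g.
    by move=> _; have := gl i; rewrite eq_sym bi => /(_ ji); lia.
  apply: nfi; have -> : f j = (f j - phi e * g) + phi e * g by ring.
  apply: (subspaceD (subspace_ord_ge _ _)); last exact: (subspaceZ (subspace_ord_ge _ _)).
  apply: cS; apply/riemann_roch_atP; split.
    apply: (subspaceB subspace_regular_outside) => //.
    exact: (subspaceZ subspace_regular_outside).
  move=> l; have [->|lj] := eqVneq l j; first by apply: ord_geW ev; lia.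
  apply: (subspaceB (subspace_ord_ge _ _)); first exact: fjo.
  apply: (subspaceZ (subspace_ord_ge _ _)) => _.
  by have := gl _ lj; rewrite ffunE; case: (l != i); lia.
split=> [l|l]; rewrite inE; first by move=> /eqP ->; rewrite bi ci.
by move=> li; rewrite bE //; have := ac l; lia.
Qed.

(** A function with pole divisor [a] would yield an element of [nabla Q b], which maximality makes
    empty. *)
Lemma below_maximal_gap a b : is_maximal Q b -> nonneg_tuples b ->
  nabla_bar b a -> nonneg_tuples a -> weierstrass_gaps Q a.
Proof.
move=> [_ maxb] b0 [j _ [aj al]] a0; split=> // -[_ [h h0 hpole]].
have ab l : l != j -> a l < b l by move=> lj; apply: al; rewrite inE.
have {}aj : a j = b j by apply: aj; rewrite inE.
have ph l : Num.max 0 (- vord (Q l) h) = a l.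
  by rewrite -(divisor_at_point a l) -hpole.
have no f : f != 0 -> regular_outside Q f -> vord (Q j) f = - b j ->
    (forall l, l != j -> - b l < vord (Q l) f) -> False.
  move=> f0 rf fj fl.
  suff : nabla Q b [ffun l => - vord (Q l) f] by rewrite maxb.
  split; last first.
    by apply/generalized_semigroupP; exists f; split=> // l; rewrite ffunE opprK.
  exists j => //; split=> l; rewrite inE ffunE.
    by move=> /eqP ->; rewrite fj opprK.
  by move=> /fl; lia.
(* If [a j = 0], then [h] may vanish at [Q j] and miss the order [- b j = 0]; the constant 1
   replaces it, as [b l > a l >= 0] for [l != j]. *)
have [aj0|aj0] := ltP 0 (a j).
  apply: (no h) => //.
  - move=> P PQ _; have : pole_divisor h P = 0 by rewrite hpole divisor_at_outside.
    by rewrite /pole_divisor; lia.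
  - by have := ph j; lia.
  - by move=> l /ab; have := ph l; lia.
apply: (no 1); rewrite ?oner_eq0 //.
- by move=> P _ _; rewrite vord1.
- by rewrite vord1; have := a0 j; lia.
- by move=> l /ab; rewrite vord1; have := a0 l; lia.
Qed.

End Tuples.

Theorem theorem3p1 (k : finFieldType) (X : curve k)
  (genus_gt0 : (0 < genus X)%N)
  (m : nat) (m_ge2 : (2 <= m)%N)
  (Q : 'I_m -> closed_point X)
  (Q_rational : forall i : 'I_m, rational_point (Q i))
  (Q_distinct : injective Q)
  (q_ge_m : (m <= #|k|)%N) :
  weierstrass_gaps Q =
  \bigcup_(beta in nonneg_relative_maximal Q)
    (nabla_bar beta `&` nonneg_tuples).
Proof.
apply/seteqP; split=> a.
  move=> [a0 na].
  (* If no index blocked [a], every coordinate would be attained in [L(a)] and [a] would be in the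
     semigroup. *)
  have [i ai] : exists i, riemann_roch_space (divisor_at Q a) `<=`
      ord_ge (Q i) (- a i + 1).
    apply: contrapT => noi; apply: na; apply: weierstrass_semigroup_orders => // i _.
    apply: contrapT => nof; apply: noi; exists i => f Lf.
    by apply: contrapT => nf; apply: nof; exists f.
  have [|b Lb ab] := gap_below_relative_maximal genus_gt0 Q_rational Q_distinct
    q_ge_m a0 _ ai.
    have /card_gt0P[j] : (0 < #|[set~ i]%SET|)%N.
      by rewrite cardsC1 card_ord; lia.
    by rewrite !inE => ji; exists j.
  by exists b => //; split=> //; exists i.
move=> [b [[maxb _] b0] [ba a0]].
exact: below_maximal_gap maxb b0 ba a0.
Qed.
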